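(* Let $u(n,q)$, $n\ge 0$, be defined by the formal power series identity $$\sum_{n\ge 0}u(n,q)x^n=\frac{1}{\sum_{n\ge 0}q^{\binom n2}x^n}.$$ Then for every integer $m\ge 0$, $$r_{m,1}(q)=\frac{u(m+2,q)}{1-q}.$$
   Context: Let $q$ be an indeterminate. Set $a(n,q)=q^{\binom n2}$ for integers $n\ge 0$ and $a(n,q)=0$ for integers $n<0$. For integers $m\ge 0$ and $n\ge 1$ define the Hankel determinant $$D_{-m,n}(q)=\det\bigl(a(-m+i+j,q)\bigr)_{i,j=0}^{n-1},$$ and set $D_{-m,0}(q)=1$. The determinant $D_{0,n+1}(q)$ is a nonzero polynomial for every $n\ge 0$, so for integers $m,n\ge 0$ a rational function $r_{m,n}(q)$ is uniquely determined by $$D_{-m,n+m+1}(q)=(-1)^{\binom{m+1}{2}}\,r_{m,n}(q)\,q^{m\binom n2}\,D_{0,n+1}(q).$$ *)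

(* Defs.v *)
From HB Require Import structures.
From mathcomp Require Import all_boot all_order all_algebra.

Set Implicit Arguments.
Unset Strict Implicit.
Unset Printing Implicit Defensive.

Import Order.TTheory GRing.Theory Num.Theory.
Local Open Scope ring_scope.

(* The field Q(q) of rational functions in the indeterminate q. *)
Notation Qq := {fraction {poly rat}}.

Definition q : Qq := tofrac 'X.

Definition a (n : int) : Qq :=
  match n with
  | Posz k => q ^+ 'C(k, 2)
  | Negz _ => 0
  end.

(* hankel m n is D_{-m,n}(q); the index - m + i + j is computed in int.
   For n = 0 the determinant of the empty matrix is 1 (hankel0). *)
Definition hankel (m n : nat) : Qq :=
  \det (\matrix_(i < n, j < n) a (- m%:Z + i%:Z + j%:Z)).

Lemma hankel0 m : hankel m 0 = 1.
Proof. exact: det_mx00. Qed.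

(* A formal power series over R is represented by its coefficient sequence;
   multiplication is the Cauchy product. *)
Definition fps_mul (R : pzRingType) (f g : nat -> R) : nat -> R :=
  fun n => \sum_(k < n.+1) f k * g (n - k)%N.

Definition fps1 (R : pzRingType) : nat -> R := fun n => (n == 0%N)%:R.
Arguments fps1 {R}.

(* g = 1 / f as formal power series. *)
Definition fps_is_inv (R : pzRingType) (f g : nat -> R) : Prop :=
  fps_mul g f =1 fps1.

(* u is the coefficient sequence of the reciprocal of the power series
   with coefficients a(n,q), n >= 0. *)
Definition reciprocal_coeffs (u : nat -> Qq) : Prop :=
  fps_is_inv (fun n => a n%:Z) u.

(* The defining relation of the family r_{m,n}(q). It has exactly one solution
   (hankel_ratio_exists, hankel_ratioE), since D_{0,n+1}(q) != 0. *)
Definition hankel_ratio (r : nat -> nat -> Qq) : Prop :=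
  forall m n : nat,
    hankel m (n + m + 1) =
      (-1) ^+ 'C(m + 1, 2) * r m n * q ^+ (m * 'C(n, 2)) * hankel 0 (n + 1).

Lemma q_neq0 : q != 0.
Proof. by rewrite /q tofrac_eq0 polyX_eq0. Qed.

Lemma q_exp_inj : injective (fun n => q ^+ n).
Proof.
move=> i j /eqP; rewrite /q -!tofracXn tofrac_eq => /eqP eqX.
by have := congr1 (fun p : {poly rat} => size p) eqX; rewrite !size_polyXn => -[].
Qed.

Lemma bin2D i j : 'C(i + j, 2) = ('C(i, 2) + 'C(j, 2) + i * j)%N.
Proof.
elim: i => [|i IHi]; first by rewrite addn0.
rewrite addSn !binS !bin1 IHi mulSn.
rewrite -!addnA; congr addn; rewrite [RHS]addnCA; congr addn.
by rewrite addnCA [(_ + j)%N]addnC.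
Qed.

Lemma hankel0m_neq0 n : hankel 0 n != 0.
Proof.
pose d : 'rV[Qq]_n := \row_i q ^+ 'C(i, 2).
pose v : 'rV[Qq]_n := \row_j q ^+ j.
have -> : hankel 0 n = \det (diag_mx d *m Vandermonde n v *m diag_mx d).
  congr (\det _); apply/matrixP=> i j.
  rewrite mul_mx_diag mul_diag_mx !mxE oppr0 add0r -PoszD /a bin2D.
  by rewrite -exprM mulnC [(j * i)%N]mulnC !exprD mulrAC mulnC.
have d_neq0 : \det (diag_mx d) != 0.
  by rewrite det_diag; apply/prodf_neq0=> i _; rewrite mxE expf_neq0 ?q_neq0.
rewrite !det_mulmx; apply: mulf_neq0; last exact: d_neq0.
apply: mulf_neq0; first exact: d_neq0.
rewrite det_Vandermonde.
apply/prodf_neq0=> i _; apply/prodf_neq0=> j ltij.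
rewrite !mxE subr_eq0; apply: contraTneq ltij => /q_exp_inj ->.
by rewrite ltnn.
Qed.

Lemma hankel_ratioE r :
  hankel_ratio r <->
  forall m n, r m n =
    (-1) ^+ 'C(m + 1, 2) * hankel m (n + m + 1)
      / (q ^+ (m * 'C(n, 2)) * hankel 0 (n + 1)).
Proof.
have nz m n : q ^+ (m * 'C(n, 2)) * hankel 0 (n + 1) != 0.
  by apply: mulf_neq0; [exact: (expf_neq0 _ q_neq0) | exact: hankel0m_neq0].
split=> hr m n; rewrite hr.
  by rewrite -[_ * r m n * _ * _]mulrA -[_ * r m n * _]mulrA signrMK mulfK.
by rewrite -!mulrA signrMK mulVf ?mulr1.
Qed.

Lemma hankel_ratio_exists : exists r, hankel_ratio r.
Proof. by exists (fun m n => (-1) ^+ 'C(m + 1, 2) * hankel m (n + m + 1)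
  / (q ^+ (m * 'C(n, 2)) * hankel 0 (n + 1))); apply/hankel_ratioE. Qed.

Lemma reciprocal_coeffs_exists : exists u, reciprocal_coeffs u.
Proof.
pose s := fix s n : seq Qq := if n is k.+1 then
  rcons (s k) (fps1 k - \sum_(i < k) (s k)`_i * a (k - i)%N) else [::].
have size_s n : size (s n) = n by elim: n => //= n IHn; rewrite size_rcons IHn.
have nth_s k n : (k < n)%N -> (s n)`_k = (s k.+1)`_k.
  elim: n => // n IHn; rewrite ltnS leq_eqVlt => /predU1P[->//|ltkn].
  by rewrite [s n.+1]/= nth_rcons size_s ltkn IHn.
exists (fun n => (s n.+1)`_n) => n.
rewrite /fps_mul big_ord_recr /= subnn mulr1 nth_rcons size_s ltnn eqxx.
apply/eqP; rewrite addrC -[eqbRHS]addr0 -addrA (inj_eq (addrI _)).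
rewrite addrC subr_eq0; apply/eqP/eq_bigr => i _.
by rewrite (nth_s i n (ltn_ord i)).
Qed.

(* Main.v *)
Require Import Defs.
From mathcomp Require Import all_boot all_order all_algebra.
From mathcomp Require Import zify ring.
Import GRing.Theory.
Local Open Scope ring_scope.

(** The Hankel matrix B of D_{-(m+2),m+3}(q) vanishes above the antidiagonal
    and has ones on it, so its determinant is a sign.  Deleting its first row
    and first column leaves the matrix of D_{-m,m+2}(q), while the reversed
    vector (u(m+2,q), ..., u(0,q)) is mapped by B to the first basis vector;
    by Cramer's rule D_{-m,m+2}(q) is therefore that sign times u(m+2,q). *)

Definition hankel_mx (R : pzRingType) (f : int -> R) (k n : nat) : 'M[R]_n :=
  \matrix_(i, j) f (- k%:Z + i%:Z + j%:Z).

(** Induction along the first row: only its last entry is nonzero, its minor is the matrix of the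
    previous step, and the cofactor signs add up by Pascal's rule. *)
Lemma det_antitriangular_hankel (R : comNzRingType) (f : int -> R) (k : nat) :
  f 0 = 1 -> (forall n, f (Negz n) = 0) ->
  \det (hankel_mx R f k k.+1) = (-1) ^+ 'C(k.+1, 2).
Proof.
move=> f0 fN; elim: k => [|k IHk]; first by rewrite det_mx11 mxE.
rewrite (expand_det_row _ ord0) (bigD1 ord_max) //= big1 ?addr0 => [|j neqj].
  rewrite mxE /= addr0 addNr f0 mul1r /cofactor /= add0n binS bin1 addnC exprD.
  congr (_ * _); rewrite -IHk; congr (\det _); apply/matrixP=> i j.
  by rewrite !mxE lift_max lift0; congr f; lia.
rewrite mxE; have -> : - k.+1%:Z + (ord0 : 'I_k.+2)%:Z + j%:Z = Negz (k - j).
  by move: neqj (ltn_ord j); rewrite -val_eqE /= NegzE; lia.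
by rewrite fN mul0r.
Qed.

Lemma det_hankel_reciprocal (R : comNzRingType) (f : int -> R) (u : nat -> R)
    (m : nat) :
  f 0 = 1 -> (forall n, f (Negz n) = 0) -> fps_is_inv (fun n => f n%:Z) u ->
  \det (hankel_mx R f m m.+2) = (-1) ^+ 'C(m.+3, 2) * u m.+2.
Proof.
move=> f0 fN fu; set B := hankel_mx R f m.+2 m.+3.
pose v : 'cV[R]_m.+3 := \col_j u (m.+2 - j)%N.
have Bv : B *m v = delta_mx ord0 ord0.
  apply/matrixP=> i j; rewrite !mxE ord1 eqxx andbT.
  (* Reversing the summation index to [l] turns the summand into [f (i - l) * u l]; terms with
     [l > i] vanish, leaving a Cauchy product coefficient. *)
  rewrite (reindex_inj rev_ord_inj) /=.
  transitivity (fps_mul u (fun n => f n%:Z) i); last by rewrite fu.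
  rewrite /fps_mul (big_ord_widen _ (fun l => u l * f (i - l)%N) (ltn_ord i)).
  rewrite [RHS]big_mkcond; apply: eq_bigr => l _; rewrite !mxE /= mulrC.
  have ltl := ltn_ord l.
  have -> : (m.+2 - (m.+3 - l.+1))%N = l by lia.
  case: ltnP => leli; first by congr (_ * f _); lia.
  have -> : - m.+2%:Z + i%:Z + (m.+3 - l.+1)%N%:Z = Negz (l - i).-1.
    by rewrite NegzE; lia.
  by rewrite fN mulr0.
(* The top entry reads [\det B * u m.+2] on the left and the (0,0) cofactor of [B] on the right. *)
have := congr1 (fun w => (\adj B *m w) ord0 ord0) Bv.
rewrite mulmxA mul_adj_mx mul_scalar_mx mxE [v _ _]mxE subn0.
rewrite det_antitriangular_hankel // -colE !mxE => ->.
rewrite /cofactor expr0 mul1r; congr (\det _).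
by apply/matrixP=> i j; rewrite !mxE !lift0; congr f; lia.
Qed.

Theorem theorem3
  (r : nat -> nat -> Qq) (hr : hankel_ratio r)
  (u : nat -> Qq) (hu : reciprocal_coeffs u)
  (m : nat) :
  r m 1%N = u (m + 2)%N / (1 - q).
Proof.
have D02 : hankel 0 2 = - (1 - q).
  rewrite /hankel (expand_det_row _ ord0) !big_ord_recl big_ord0 /cofactor.
  rewrite !det_mx11 !mxE.
  rewrite -[LHS]/(1 * (1 * q ^+ 1) + (1 * ((-1) ^+ 1 * 1) + 0)).
  ring.
have q1 : 1 - q != 0.
  by have := hankel0m_neq0 2; rewrite D02 oppr_eq0.
have := hr m 1%N; rewrite muln0 expr0 mulr1 D02 add1n !addn1 addn2.
rewrite (_ : hankel m m.+2 = \det (hankel_mx Qq a m m.+2)) //.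
rewrite (det_hankel_reciprocal Qq a u) // !(binS _ 1) !bin1.
(* ['C(m.+3, 2)] and ['C(m.+1, 2)] differ by an odd number; the resulting sign cancels the one in
   [D02]. *)
have -> : ('C(m, 2) + m + m.+1 + m.+2 = 'C(m, 2) + m + (m.+1).*2.+1)%N by lia.
rewrite exprD exprS -mul2n exprM sqrrN !expr1n mulr1 mulrN1 mulNr mulrN.
move/oppr_inj; rewrite -mulrA => eq_u.
by rewrite (inv_inj (signrMK _) eq_u) mulfK.
Qed.
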